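(* Let $E$ be a row-finite directed graph with no sources, and consider the trivial group $\{0\}$ acting trivially on $E$ with the trivial one-cocycle $\varphi=0$. Let $R$ be a unital commutative ring (regarded as a $*$-ring with the trivial involution). Then there is an $R$-algebra isomorphism $\pi_1\colon L_R(E)\to L_R(\{0\},E)$ from the Leavitt path algebra of $E$ such that $$\pi_1(p_v)=p_{v,0},\qquad \pi_1(x_e)=s_{e,0},\qquad \pi_1(y_e)=s_{e,0}^*$$ for all $v\in E^0$, $e\in E^1$.
   Context: A directed graph $E=(E^0,E^1,r,s)$ has countable vertex set $E^0$, countable edge set $E^1$ and maps $r,s\colon E^1\to E^0$. It is row-finite if $vE^1:=r^{-1}(v)$ is finite for all $v$, and has no sources if $vE^1\neq\emptyset$ for all $v$. The Leavitt path algebra $L_R(E)$ (with the convention used here) is the universal $R$-algebra generated by $\{p_v,x_e,y_e:v\in E^0,e\in E^1\}$ subject to: $p_vp_{v'}=\delta_{v,v'}p_v$; $p_{r(e)}x_e=x_ep_{s(e)}=x_e$; $p_{s(e)}y_e=y_ep_{r(e)}=y_e$; $y_ex_{e'}=\delta_{e,e'}p_{s(e)}$; $p_v=\sum_{r(e)=v}x_ey_e$ for all $v\in r(E^1)$. A $*$-algebra over a commutative unital ring $R$ with involution $r\mapsto r^*$ is an (associative, not necessarily unital) $R$-algebra with a map $a\mapsto a^*$ satisfying $(a^* )^*=a$, $(ab)^*=b^*a^*$, $(ra+b)^*=r^*a^*+b^*$. A projection is $p=p^*=p^2$; a partial isometry is $s=ss^*s$. An $E$-family in a $*$-algebra: mutually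 orthogonal projections $P_v$ ($v\in E^0$) and partial isometries $S_e$ ($e\in E^1$) with $S_e^*S_f=\delta_{e,f}P_{s(e)}$ and $P_v=\sum_{e\in vE^1}S_eS_e^*$. $L_R(\{0\},E)$ is the universal $*$-algebra over $R$ generated by elements $p_{v,0}$, $s_{e,0}$ such that $\{p_{v,0}:v\in E^0\}\cup\{s_{e,0}:e\in E^1\}$ is an $E$-family, $(p_{v,0})^*=p_{v,0}$, $p_{v,0}p_{w,0}=\delta_{v,w}p_{v,0}$, $p_{v,0}s_{e,0}=\delta_{v,r(e)}s_{e,0}$, $s_{e,0}p_{v,0}=\delta_{v,s(e)}s_{e,0}$. *)

(* Defs.v *)
From HB Require Import structures.
From mathcomp Require Import all_boot all_algebra generic_quotient finmap.
From mathcomp Require Import boolp classical_sets functions cardinality.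

Set Implicit Arguments.
Unset Strict Implicit.
Unset Printing Implicit Defensive.

Import GRing.Theory.
Local Open Scope quotient_scope.
Local Open Scope ring_scope.

Declare Scope expr_scope.
Delimit Scope expr_scope with expr.
Reserved Notation "x ** y" (at level 40, left associativity).

(* Associative, not necessarily unital, algebras. (The rings and algebras of
   MathComp all have a unit.) *)
HB.mixin Record isNUAlgebra (R : comPzRingType) A of GRing.Lmodule R A := {
  nmul : A -> A -> A;
  nmulA : associative nmul;
  nmulDl : left_distributive nmul +%R;
  nmulDr : right_distributive nmul +%R;
  nscalerAl : forall (a : R) (x y : A), a *: nmul x y = nmul (a *: x) y;
  nscalerAr : forall (a : R) (x y : A), a *: nmul x y = nmul x (a *: y)
}.
#[short(type="nuAlgType")]
HB.structure Definition NUAlgebra (R : comPzRingType) :=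
  { A of GRing.Lmodule R A & isNUAlgebra R A }.

Notation "x ** y" := (nmul x y) : ring_scope.

(* No clause for 1: it follows from involutivity and multiplicativity; and R is
   commutative, so multiplicative and antimultiplicative maps agree. *)
Record ring_involution (R : comPzRingType) := RingInvolution {
  ring_inv :> R -> R;
  ring_invK : involutive ring_inv;
  ring_invD : {morph ring_inv : a b / a + b};
  ring_invM : {morph ring_inv : a b / a * b}
}.

Definition trivial_involution (R : comPzRingType) : ring_involution R :=
  @RingInvolution R id (fun=> erefl) (fun _ _ => erefl) (fun _ _ => erefl).

HB.mixin Record isStarAlgebra (R : comPzRingType) (c : ring_involution R) A
    of NUAlgebra R A := {
  star : A -> A;
  starK : involutive star;
  starM : forall x y : A, star (nmul x y) = nmul (star y) (star x);
  starP : forall (a : R) (x y : A),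
    star (a *: x + y) = c a *: star x + star y
}.
#[short(type="starAlgType")]
HB.structure Definition StarAlgebra (R : comPzRingType)
    (c : ring_involution R) :=
  { A of NUAlgebra R A & isStarAlgebra R c A }.

(* Nonunital R-algebras equipped with a family U of unary operations, presented
   by generators X and relations rel: formal expressions in X, modulo the least
   congruence containing the algebra axioms and rel. For U = void these are the
   universal nonunital R-algebras; the involution of a *-algebra is treated as a
   unary operation (U = unit), whose axioms are then part of the relations. *)
Section PresentedAlgebra.
Variables (R : comPzRingType) (U X : Type).

Inductive term : Type :=
| tgen of X
| tzero
| topp of term
| tadd of term & term
| tscale of R & term
| tmul of term & term
| tun of U & term.

HB.instance Definition _ := gen_eqMixin term.
HB.instance Definition _ := gen_choiceMixin term.

Variable rel : term -> term -> Prop.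

Inductive tcong : term -> term -> Prop :=
| tcong_rel t u : rel t u -> tcong t u
| tcong_refl t : tcong t t
| tcong_sym t u : tcong t u -> tcong u t
| tcong_trans t u v : tcong t u -> tcong u v -> tcong t v
| tcong_opp t t' : tcong t t' -> tcong (topp t) (topp t')
| tcong_add t t' u u' :
    tcong t t' -> tcong u u' -> tcong (tadd t u) (tadd t' u')
| tcong_scale a t t' : tcong t t' -> tcong (tscale a t) (tscale a t')
| tcong_mul t t' u u' :
    tcong t t' -> tcong u u' -> tcong (tmul t u) (tmul t' u')
| tcong_un o t t' : tcong t t' -> tcong (tun o t) (tun o t')
| tcong_addA t u v : tcong (tadd t (tadd u v)) (tadd (tadd t u) v)
| tcong_addC t u : tcong (tadd t u) (tadd u t)
| tcong_add0 t : tcong (tadd tzero t) t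
| tcong_addN t : tcong (tadd (topp t) t) tzero
| tcong_scaleA a b t : tcong (tscale a (tscale b t)) (tscale (a * b) t)
| tcong_scale1 t : tcong (tscale 1 t) t
| tcong_scaleDr a t u :
    tcong (tscale a (tadd t u)) (tadd (tscale a t) (tscale a u))
| tcong_scaleDl a b t :
    tcong (tscale (a + b) t) (tadd (tscale a t) (tscale b t))
| tcong_mulA t u v : tcong (tmul t (tmul u v)) (tmul (tmul t u) v)
| tcong_mulDl t u v : tcong (tmul (tadd t u) v) (tadd (tmul t v) (tmul u v))
| tcong_mulDr t u v : tcong (tmul t (tadd u v)) (tadd (tmul t u) (tmul t v))
| tcong_scaleAl a t u : tcong (tscale a (tmul t u)) (tmul (tscale a t) u)
| tcong_scaleAr a t u : tcong (tscale a (tmul t u)) (tmul t (tscale a u)).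

Definition tcongb t u := `[< tcong t u >].

Lemma tcongb_refl : reflexive tcongb.
Proof. by move=> t; apply/asboolP/tcong_refl. Qed.

Lemma tcongb_sym : symmetric tcongb.
Proof. by move=> t u; apply/asboolP/asboolP; apply: tcong_sym. Qed.

Lemma tcongb_trans : transitive tcongb.
Proof.
by move=> u t v /asboolP tu /asboolP uv; apply/asboolP; apply: tcong_trans uv.
Qed.

Definition tcong_equiv := EquivRel tcongb tcongb_refl tcongb_sym tcongb_trans.

Definition presented := {eq_quot tcong_equiv}.

HB.instance Definition _ := Choice.on presented.

Definition pclass (t : term) : presented := \pi_{eq_quot tcong_equiv} t.

Lemma pclassP t u : pclass t = pclass u <-> tcong t u.
Proof.
split=> [/eqquotP /asboolP //|tu].
by apply/eqquotP; apply/asboolP.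
Qed.

Lemma pclassW (P : presented -> Prop) :
  (forall t, P (pclass t)) -> forall x, P x.
Proof. by move=> Pt x; rewrite -[x]reprK; apply: Pt. Qed.

Lemma reprC t : tcong (repr (pclass t)) t.
Proof. by apply/pclassP; rewrite /pclass reprK. Qed.

Definition pzero := pclass tzero.
Definition popp (x : presented) := pclass (topp (repr x)).
Definition padd (x y : presented) := pclass (tadd (repr x) (repr y)).
Definition pscale (a : R) (x : presented) := pclass (tscale a (repr x)).
Definition pmul (x y : presented) := pclass (tmul (repr x) (repr y)).
Definition pun (o : U) (x : presented) := pclass (tun o (repr x)).

Lemma poppE t : popp (pclass t) = pclass (topp t).
Proof. by apply/pclassP/tcong_opp/reprC. Qed.
Lemma paddE t u : padd (pclass t) (pclass u) = pclass (tadd t u).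
Proof. by apply/pclassP/tcong_add; apply: reprC. Qed.
Lemma pscaleE a t : pscale a (pclass t) = pclass (tscale a t).
Proof. by apply/pclassP/tcong_scale/reprC. Qed.
Lemma pmulE t u : pmul (pclass t) (pclass u) = pclass (tmul t u).
Proof. by apply/pclassP/tcong_mul; apply: reprC. Qed.
Lemma punE o t : pun o (pclass t) = pclass (tun o t).
Proof. by apply/pclassP/tcong_un/reprC. Qed.

Let pE := (poppE, paddE, pscaleE, pmulE).

Fact paddA : associative padd.
Proof.
elim/pclassW=> t; elim/pclassW=> u; elim/pclassW=> v.
by rewrite !pE; apply/pclassP/tcong_addA.
Qed.
Fact paddC : commutative padd.
Proof.
elim/pclassW=> t; elim/pclassW=> u; rewrite !pE.
exact/pclassP/tcong_addC.
Qed.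
Fact padd0 : left_id pzero padd.
Proof. by elim/pclassW=> t; rewrite !pE; apply/pclassP/tcong_add0. Qed.
Fact paddN : left_inverse pzero popp padd.
Proof. by elim/pclassW=> t; rewrite !pE; apply/pclassP/tcong_addN. Qed.

HB.instance Definition _ :=
  GRing.isZmodule.Build presented paddA paddC padd0 paddN.

Lemma pclassD t u : pclass (tadd t u) = pclass t + pclass u.
Proof. by rewrite -paddE. Qed.
Lemma pclassN t : pclass (topp t) = - pclass t.
Proof. by rewrite -poppE. Qed.

Fact pscaleA a b x : pscale a (pscale b x) = pscale (a * b) x.
Proof. by elim/pclassW: x => t; rewrite !pE; apply/pclassP/tcong_scaleA. Qed.
Fact pscale1 : left_id 1 pscale.
Proof. by elim/pclassW=> t; rewrite !pE; apply/pclassP/tcong_scale1. Qed.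
Fact pscaleDr : right_distributive pscale +%R.
Proof.
move=> a; elim/pclassW=> t; elim/pclassW=> u.
by rewrite -pclassD !pE -pclassD; apply/pclassP/tcong_scaleDr.
Qed.
Fact pscaleDl x : {morph pscale^~ x : a b / a + b}.
Proof.
by elim/pclassW: x => t a b; rewrite !pE -pclassD; apply/pclassP/tcong_scaleDl.
Qed.

HB.instance Definition _ := GRing.Zmodule_isLmodule.Build R presented
  pscaleA pscale1 pscaleDr pscaleDl.

Lemma pclassZ a t : pclass (tscale a t) = a *: pclass t.
Proof. by rewrite -pscaleE. Qed.

Fact pmulA : associative pmul.
Proof.
elim/pclassW=> t; elim/pclassW=> u; elim/pclassW=> v.
by rewrite !pE; apply/pclassP/tcong_mulA.
Qed.
Fact pmulDl : left_distributive pmul +%R.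
Proof.
elim/pclassW=> t; elim/pclassW=> u; elim/pclassW=> v.
by rewrite -pclassD !pE -pclassD; apply/pclassP/tcong_mulDl.
Qed.
Fact pmulDr : right_distributive pmul +%R.
Proof.
elim/pclassW=> t; elim/pclassW=> u; elim/pclassW=> v.
by rewrite -pclassD !pE -pclassD; apply/pclassP/tcong_mulDr.
Qed.
Fact pscaleAl (a : R) (x y : presented) : a *: pmul x y = pmul (a *: x) y.
Proof.
elim/pclassW: x => t; elim/pclassW: y => u.
by rewrite -pclassZ !pE -pclassZ; apply/pclassP/tcong_scaleAl.
Qed.
Fact pscaleAr (a : R) (x y : presented) : a *: pmul x y = pmul x (a *: y).
Proof.
elim/pclassW: x => t; elim/pclassW: y => u.
by rewrite -pclassZ !pE -pclassZ; apply/pclassP/tcong_scaleAr.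
Qed.

HB.instance Definition _ := isNUAlgebra.Build R presented
  pmulA pmulDl pmulDr pscaleAl pscaleAr.

Lemma pclassM t u : pclass (tmul t u) = pclass t ** pclass u.
Proof. by rewrite -pmulE. Qed.

Definition pgen (x : X) : presented := pclass (tgen x).

Fixpoint teval (A : nuAlgType R) (op : U -> A -> A) (f : X -> A) (t : term)
    : A :=
  match t with
  | tgen x => f x
  | tzero => 0
  | topp t => - teval op f t
  | tadd t u => teval op f t + teval op f u
  | tscale a t => a *: teval op f t
  | tmul t u => teval op f t ** teval op f u
  | tun o t => op o (teval op f t)
  end.

Lemma teval_pgen t : teval pun pgen t = pclass t.
Proof.
elim: t => [x||t IHt|t IHt u IHu|a t IHt|t IHt u IHu|o t IHt] //=.
- by rewrite IHt pclassN.
- by rewrite IHt IHu pclassD.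
- by rewrite IHt pclassZ.
- by rewrite IHt IHu pclassM.
- by rewrite IHt punE.
Qed.

Lemma pgen_rel t u : rel t u -> teval pun pgen t = teval pun pgen u.
Proof. by move=> tu; rewrite !teval_pgen; apply/pclassP/tcong_rel. Qed.

Section Universal.
Variables (A : nuAlgType R) (op : U -> A -> A) (f : X -> A).
Hypothesis frel : forall t u, rel t u -> teval op f t = teval op f u.

Lemma teval_tcong t u : tcong t u -> teval op f t = teval op f u.
Proof.
elim=> {t u} //=; try congruence.
- by move=> *; apply: addrA.
- by move=> *; apply: addrC.
- by move=> *; apply: add0r.
- by move=> *; apply: addNr.
- by move=> *; apply: scalerA.
- by move=> *; apply: scale1r.
- by move=> *; apply: scalerDr.
- by move=> *; apply: scalerDl.
- by move=> *; apply: nmulA.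
- by move=> *; apply: nmulDl.
- by move=> *; apply: nmulDr.
- by move=> *; apply: nscalerAl.
- by move=> *; apply: nscalerAr.
Qed.

Theorem presented_universal :
  exists! F : presented -> A,
    [/\ linear F, {morph F : x y / x ** y},
        forall o x, F (pun o x) = op o (F x) & forall x, F (pgen x) = f x].
Proof.
pose G (x : presented) := teval op f (repr x).
have GE t : G (pclass t) = teval op f t by apply: teval_tcong (reprC t).
exists G; split=> [|F [Flin FM Fun Fgen]].
  split=> [a||o| x]; last by rewrite GE.
  - elim/pclassW=> t; elim/pclassW=> u.
    by rewrite -pclassZ -pclassD !GE.
  - elim/pclassW=> t; elim/pclassW=> u.
    by rewrite -pclassM !GE.
  - by elim/pclassW=> t; rewrite punE !GE.
pose FL : {linear presented -> A} :=
  HB.pack F (GRing.isLinear.Build R presented A _ F Flin).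
have FD u v : F (u + v) = F u + F v by exact: (raddfD FL).
have FN u : F (- u) = - F u by exact: (raddfN FL).
have F0 : F 0 = 0 by exact: (raddf0 FL).
have FZ a u : F (a *: u) = a *: F u by rewrite -[a *: u]addr0 Flin F0 addr0.
apply/funext; elim/pclassW=> t; rewrite GE.
elim: t => [x||t IHt|t IHt u IHu|a t IHt|t IHt u IHu|o t IHt] /=.
- by rewrite -Fgen.
- by rewrite -F0.
- by rewrite IHt pclassN FN.
- by rewrite IHt IHu pclassD FD.
- by rewrite IHt pclassZ FZ.
- by rewrite IHt IHu pclassM FM.
- by rewrite IHt -punE Fun.
Qed.

End Universal.
End PresentedAlgebra.

Arguments tgen {R U X}.
Arguments tzero {R U X}.
Arguments pgen {R U X} rel.

Notation tstar := (tun tt).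
Notation "0" := tzero : expr_scope.
Notation "t + u" := (tadd t u) : expr_scope.
Notation "a *: t" := (tscale a t) : expr_scope.
Notation "t ** u" := (tmul t u) : expr_scope.
Local Open Scope expr_scope.

Definition tsum {R : comPzRingType} {U X : Type} (s : seq (term R U X)) :
  term R U X := foldr (@tadd R U X) 0%expr s.

Lemma teval_tsum (R : comPzRingType) (U X : Type) (A : nuAlgType R)
    (op : U -> A -> A) (f : X -> A) (s : seq (term R U X)) :
  teval op f (tsum s) = (\sum_(t <- s) teval op f t)%R.
Proof. by elim: s => [|t s IHs] /=; rewrite ?big_nil// big_cons IHs. Qed.

Definition universal_algebra (R : comPzRingType) (X : Type)
  (rel : term R void X -> term R void X -> Prop) : nuAlgType R := presented rel.

Lemma universal_algebra_rel (R : comPzRingType) (X : Type)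
    (rel : term R void X -> term R void X -> Prop) t u : rel t u ->
  teval (A := universal_algebra rel) (fun o : void => of_void _ o)
    (pgen rel) t =
  teval (A := universal_algebra rel) (fun o : void => of_void _ o)
    (pgen rel) u.
Proof.
move=> tu; have := pgen_rel tu.
by rewrite (_ : pun (rel:=rel) = fun o : void => of_void _ o)//; apply/funext; case.
Qed.

Theorem universal_algebraP (R : comPzRingType) (X : Type)
    (rel : term R void X -> term R void X -> Prop)
    (A : nuAlgType R) (f : X -> A) :
    (forall t u, rel t u ->
       teval (fun o : void => of_void _ o) f t =
       teval (fun o : void => of_void _ o) f u) ->
  exists! F : universal_algebra rel -> A,
    [/\ linear F, {morph F : x y / nmul x y} & forall x, F (pgen rel x) = f x].
Proof.
move=> /presented_universal [F [[Flin FM _ Fgen] Funiq]]; exists F.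
by split=> // G [Glin GM Ggen]; apply: Funiq; split=> // -[].
Qed.

Section StarPresented.
Variables (R : comPzRingType) (c : ring_involution R) (X : Type).
Variable rel : term R unit X -> term R unit X -> Prop.

Inductive star_rel : term R unit X -> term R unit X -> Prop :=
| star_rel_rel t u : rel t u -> star_rel t u
| star_rel_K t : star_rel (tstar (tstar t)) t
| star_rel_M t u : star_rel (tstar (t ** u)) (tstar u ** tstar t)
| star_rel_P a t u :
    star_rel (tstar (a *: t + u)) (c a *: tstar t + tstar u).

Definition star_presented : Type := presented star_rel.

HB.instance Definition _ := NUAlgebra.on star_presented.

Let pstar : star_presented -> star_presented := pun tt.

Fact pstarK : involutive pstar.
Proof.
elim/pclassW=> t; rewrite /pstar !punE.
exact/pclassP/tcong_rel/star_rel_K.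
Qed.
Fact pstarM x y : pstar (nmul x y) = nmul (pstar y) (pstar x).
Proof.
elim/pclassW: x => t; elim/pclassW: y => u.
rewrite /pstar -pclassM !punE -pclassM.
exact/pclassP/tcong_rel/star_rel_M.
Qed.
Fact pstarP (a : R) (x y : star_presented) :
  pstar (a *: x + y)%R = (c a *: pstar x + pstar y)%R.
Proof.
elim/pclassW: x => t; elim/pclassW: y => u.
rewrite /pstar -pclassZ -pclassD !punE -pclassZ -pclassD.
exact/pclassP/tcong_rel/star_rel_P.
Qed.

HB.instance Definition _ :=
  isStarAlgebra.Build R c star_presented pstarK pstarM pstarP.

Definition universal_star_algebra : starAlgType c := star_presented.

Definition sgen (x : X) : universal_star_algebra := pgen star_rel x.

Lemma sgen_rel t u : rel t u ->
  teval (fun=> @star R c universal_star_algebra) sgen t =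
  teval (fun=> @star R c universal_star_algebra) sgen u.
Proof.
move=> tu; have := pgen_rel (star_rel_rel tu).
by rewrite (_ : pun (rel:=star_rel) = fun=> pstar)//; apply/funext; case.
Qed.

Theorem universal_star_algebraP (A : starAlgType c) (f : X -> A) :
    (forall t u, rel t u ->
       teval (fun=> star) f t = teval (fun=> star) f u) ->
  exists! F : universal_star_algebra -> A,
    [/\ linear F, {morph F : x y / nmul x y}, {morph F : x / star x}
       & forall x, F (sgen x) = f x].
Proof.
move=> frel.
have frel' t u : star_rel t u -> teval (fun=> star) f t = teval (fun=> star) f u.
  case=> {t u} [t u|t|t u|a t u] /=; [exact: frel|exact: starK|exact: starM|].
  exact: starP.
have [F [[Flin FM Fs Fgen] Funiq]] := presented_universal frel'.
exists F; split=> [|G [Glin GM Gs Ggen]]; first by split=> // x; apply: (Fs tt).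
by apply: Funiq; split=> // -[] x; apply: Gs.
Qed.

End StarPresented.

Record digraph := Digraph {
  vertex : countType;
  edge : countType;
  rg : edge -> vertex;
  src : edge -> vertex
}.

(* The set vE^1 = r^{-1}(v). *)
Definition receives (E : digraph) (v : vertex E) : set (edge E) :=
  [set e | rg e = v]%classic.

Definition row_finite (E : digraph) := forall v : vertex E,
  finite_set (receives v).

Definition no_sources (E : digraph) := forall v : vertex E,
  (receives v !=set0)%classic.

Section LeavittPathAlgebra.
Variables (R : comPzRingType) (E : digraph).

Inductive leavitt_gen : Type :=
| gen_p of vertex E | gen_x of edge E | gen_y of edge E.

Local Notation tm := (term R void leavitt_gen).
Local Notation p v := (tgen (gen_p v)).
Local Notation x e := (tgen (gen_x e)).
Local Notation y e := (tgen (gen_y e)).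

(* The sum over vE^1 only makes sense when vE^1 is finite, which holds for every
   v when E is row-finite; fset_set is a junk value on infinite sets. The other
   premise of leavitt_sum says that v is in r(E^1). *)
Inductive leavitt_rel : tm -> tm -> Prop :=
| leavitt_pp v v' : leavitt_rel (p v ** p v') (if v == v' then p v else 0)
| leavitt_px e : leavitt_rel (p (rg e) ** x e) (x e)
| leavitt_xp e : leavitt_rel (x e ** p (src e)) (x e)
| leavitt_py e : leavitt_rel (p (src e) ** y e) (y e)
| leavitt_yp e : leavitt_rel (y e ** p (rg e)) (y e)
| leavitt_yx e e' :
    leavitt_rel (y e ** x e') (if e == e' then p (src e) else 0)
| leavitt_sum v : (receives v !=set0)%classic -> finite_set (receives v) ->
    leavitt_rel (p v) (tsum [seq x e ** y e | e <- fset_set (receives v)]).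

Definition leavitt : nuAlgType R := universal_algebra leavitt_rel.

Definition lp (v : vertex E) : leavitt := pgen leavitt_rel (gen_p v).
Definition lx (e : edge E) : leavitt := pgen leavitt_rel (gen_x e).
Definition ly (e : edge E) : leavitt := pgen leavitt_rel (gen_y e).

End LeavittPathAlgebra.

(* L_R(G, E) for the trivial group G = {0}, the trivial action on E and the
   trivial cocycle. *)
Section TrivialGroupAlgebra.
Variables (R : comPzRingType) (c : ring_involution R) (E : digraph).

Inductive efam_gen : Type := gen_p0 of vertex E | gen_s0 of edge E.

Local Notation tm := (term R unit efam_gen).
Local Notation p v := (tgen (gen_p0 v)).
Local Notation s e := (tgen (gen_s0 e)).

Inductive E_family_rel : tm -> tm -> Prop :=
| efam_p_idem v : E_family_rel (p v ** p v) (p v)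
| efam_p_star v : E_family_rel (tstar (p v)) (p v)
| efam_p_orth v w : v != w -> E_family_rel (p v ** p w) 0
| efam_s_isom e : E_family_rel (s e ** tstar (s e) ** s e) (s e)
| efam_ss e f :
    E_family_rel (tstar (s e) ** s f) (if e == f then p (src e) else 0)
| efam_sum v : finite_set (receives v) ->
    E_family_rel (p v)
      (tsum [seq s e ** tstar (s e) | e <- fset_set (receives v)]).

(* Some of these relations repeat those of an E-family, as in the presentation
   of L_R(G, E) for a general self-similar action, specialized to G = {0}. *)
Inductive trivial_group_rel : tm -> tm -> Prop :=
| trivial_E_family t u : E_family_rel t u -> trivial_group_rel t u
| trivial_p_star v : trivial_group_rel (tstar (p v)) (p v)
| trivial_pp v w : trivial_group_rel (p v ** p w) (if v == w then p v else 0)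
| trivial_ps v e :
    trivial_group_rel (p v ** s e) (if v == rg e then s e else 0)
| trivial_sp e v :
    trivial_group_rel (s e ** p v) (if v == src e then s e else 0).

Definition trivial_group_algebra : starAlgType c :=
  universal_star_algebra c trivial_group_rel.

Definition p0 (v : vertex E) : trivial_group_algebra :=
  sgen c trivial_group_rel (gen_p0 v).
Definition s0 (e : edge E) : trivial_group_algebra :=
  sgen c trivial_group_rel (gen_s0 e).

End TrivialGroupAlgebra.

(* Main.v *)
(** The Leavitt path algebra carries an involution exchanging x_e and y_e and
    fixing p_v: the defining relations are stable under this exchange combined
    with reversal of products, so it is a homomorphism from L_R(E) to its
    converse algebra. With this involution the generators of L_R(E) form an
    E-family, and those of L_R({0},E) satisfy the Leavitt relations. The two
    universal properties give homomorphisms in both directions, which are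
    mutually inverse because they are so on generators. *)

Require Import Defs.
From mathcomp Require Import all_boot all_algebra.
From HB Require Import structures.
From mathcomp Require Import finmap classical_sets cardinality.
Import GRing.Theory.
Local Open Scope ring_scope.

(** * Opposite of a nonunital algebra *)

Section ConverseAlgebra.
Context {R : comPzRingType} (A : nuAlgType R).

(** A fresh name for the carrier, so that the reversed product can be registered beside the original
    one on the same module. *)
Definition nconverse : Type := A.

HB.instance Definition _ := GRing.Lmodule.on nconverse.

Definition nconverse_mul (x y : nconverse) : nconverse := nmul (y : A) (x : A).

Fact nconverse_mulA : associative nconverse_mul.
Proof. by move=> x y z; rewrite /nconverse_mul nmulA. Qed.
Fact nconverse_mulDl : left_distributive nconverse_mul +%R.
Proof. by move=> x y z; apply: nmulDr. Qed.
Fact nconverse_mulDr : right_distributive nconverse_mul +%R.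
Proof. by move=> x y z; apply: nmulDl. Qed.
Fact nconverse_scaleAl (a : R) (x y : nconverse) :
  a *: nconverse_mul x y = nconverse_mul (a *: x) y.
Proof. exact: nscalerAr. Qed.
Fact nconverse_scaleAr (a : R) (x y : nconverse) :
  a *: nconverse_mul x y = nconverse_mul x (a *: y).
Proof. exact: nscalerAl. Qed.

HB.instance Definition _ := isNUAlgebra.Build R nconverse
  nconverse_mulA nconverse_mulDl nconverse_mulDr
  nconverse_scaleAl nconverse_scaleAr.

End ConverseAlgebra.

(** * Zero products and uniqueness of homomorphisms *)

Section NUAlgebraTheory.
Context {R : comPzRingType} {A : nuAlgType R}.
Implicit Types x y : A.

Lemma nmul0r x : 0 ** x = 0.
Proof. by rewrite -(scale0r (0 : A)) -nscalerAl !scale0r. Qed.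

Lemma nmulr0 x : x ** 0 = 0.
Proof. by rewrite -(scale0r (0 : A)) -nscalerAr !scale0r. Qed.

End NUAlgebraTheory.

(** Every element is the class of a term, and induction on that term reduces equality to the
    generators. *)
Lemma presented_ext {R : comPzRingType} {U X : Type}
    {rel : term R U X -> term R U X -> Prop} {A : nuAlgType R}
    (op : U -> A -> A) (F G : presented rel -> A) :
  linear F -> {morph F : x y / x ** y} ->
  linear G -> {morph G : x y / x ** y} ->
  (forall o x, F (pun o x) = op o (F x)) ->
  (forall o x, G (pun o x) = op o (G x)) ->
  (forall x, F (pgen rel x) = G (pgen rel x)) -> F =1 G.
Proof.
move=> Flin FM Glin GM Fop Gop FG.
pose FL : {linear presented rel -> A} :=
  HB.pack F (GRing.isLinear.Build R (presented rel) A _ F Flin).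
pose GL : {linear presented rel -> A} :=
  HB.pack G (GRing.isLinear.Build R (presented rel) A _ G Glin).
suff FGL : FL =1 GL by [].
elim/pclassW; elim=> [x||t IHt|t IHt u IHu|a t IHt|t IHt u IHu|o t IHt].
- exact: FG.
- by rewrite (raddf0 FL) (raddf0 GL).
- by rewrite pclassN !raddfN; congr (- _).
- by rewrite pclassD !raddfD; congr (_ + _).
- by rewrite pclassZ !linearZ; congr (a *: _).
- by rewrite pclassM /= FM GM; congr (_ ** _).
- by rewrite -punE /= Fop Gop; congr (op _ _).
Qed.

(** * The Leavitt path algebra: relations, universal property, involution *)

Section LeavittPathAlgebra.
Context {R : comPzRingType} {E : digraph}.
Local Notation L := (leavitt R E).
Local Notation p := (@lp R E).
Local Notation x := (@lx R E).
Local Notation y := (@ly R E).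

Lemma lpp (v w : vertex E) : p v ** p w = if v == w then p v else 0.
Proof.
by have := universal_algebra_rel (leavitt_pp R v w); case: ifP.
Qed.

Lemma lpx (e : edge E) : p (rg e) ** x e = x e.
Proof. exact: (universal_algebra_rel (leavitt_px R e)). Qed.

Lemma lxp (e : edge E) : x e ** p (src e) = x e.
Proof. exact: (universal_algebra_rel (leavitt_xp R e)). Qed.

Lemma lpy (e : edge E) : p (src e) ** y e = y e.
Proof. exact: (universal_algebra_rel (leavitt_py R e)). Qed.

Lemma lyp (e : edge E) : y e ** p (rg e) = y e.
Proof. exact: (universal_algebra_rel (leavitt_yp R e)). Qed.

Lemma lyx (e f : edge E) : y e ** x f = if e == f then p (src e) else 0.
Proof.
by have := universal_algebra_rel (leavitt_yx R e f); case: ifP.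
Qed.

Lemma lp_sum (v : vertex E) :
  (receives v !=set0)%classic -> finite_set (receives v) ->
  p v = \sum_(e <- fset_set (receives v)) x e ** y e.
Proof.
move=> v0 vfin; have := universal_algebra_rel (leavitt_sum R v0 vfin).
by rewrite teval_tsum big_map.
Qed.

Lemma leavitt_ext (A : nuAlgType R) (F G : L -> A) :
  linear F -> {morph F : a b / a ** b} ->
  linear G -> {morph G : a b / a ** b} ->
  (forall v, F (p v) = G (p v)) -> (forall e, F (x e) = G (x e)) ->
  (forall e, F (y e) = G (y e)) -> F =1 G.
Proof.
move=> Flin FM Glin GM Fp Fx Fy.
by apply: (presented_ext (fun o : void => of_void _ o)) => // -[].
Qed.

(** Existence half of the universal property, with the relations on terms turned into equations in
    [A]. It yields both the involution and the map to [L_R({0},E)]. *)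
Lemma leavittP {A : nuAlgType R} (P : vertex E -> A) (X Y : edge E -> A) :
    (forall v w, P v ** P w = if v == w then P v else 0) ->
    (forall e, P (rg e) ** X e = X e) -> (forall e, X e ** P (src e) = X e) ->
    (forall e, P (src e) ** Y e = Y e) -> (forall e, Y e ** P (rg e) = Y e) ->
    (forall e f, Y e ** X f = if e == f then P (src e) else 0) ->
    (forall v, (receives v !=set0)%classic -> finite_set (receives v) ->
       P v = \sum_(e <- fset_set (receives v)) X e ** Y e) ->
  exists F : L -> A, [/\ linear F, {morph F : a b / a ** b},
    forall v, F (p v) = P v, forall e, F (x e) = X e & forall e, F (y e) = Y e].
Proof.
move=> hpp hpx hxp hpy hyp hyx hsum.
pose f (g : leavitt_gen E) :=
  match g with gen_p v => P v | gen_x e => X e | gen_y e => Y e end.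
have [|F [[Flin FM Fgen] _]] :=
    @universal_algebraP _ _ (@leavitt_rel R E) A f.
  move=> t u []{t u} /= => [v w|e|e|e|e|e e'|v v0 vfin] //.
  - by rewrite hpp; case: ifP.
  - by rewrite hyx; case: ifP.
  - by rewrite teval_tsum big_map hsum.
by exists F; split=> // g; apply: Fgen.
Qed.

Lemma leavitt_involution : exists star : L -> L,
  [/\ involutive star, forall a b, star (a ** b) = star b ** star a,
      linear star & [/\ forall v, star (p v) = p v,
        forall e, star (x e) = y e & forall e, star (y e) = x e]].
Proof.
(* With [x] and [y] swapped, each reversed relation is again a Leavitt relation: [lpx] trades places
   with [lyp], and [lxp] with [lpy]. *)
have [|||||||F [Flin FM Fp Fx Fy]] := @leavittP (nconverse L) p y x.
- move=> v w; rewrite [LHS]lpp eq_sym.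
  by case: eqP => [->|].
- exact: lyp.
- exact: lpy.
- exact: lxp.
- exact: lpx.
- move=> e f; rewrite [LHS]lyx eq_sym.
  by case: eqP => [->|].
- exact: lp_sum.
suff FF : F \o F =1 id by exists F; split=> // a; apply: FF.
apply: (leavitt_ext L) => //=.
- by move=> k u v /=; rewrite !Flin.
(* [F] reverses products in [L], so two applications restore the order. *)
- by move=> u v /=; rewrite FM; apply: (FM (F v) (F u)).
- by move=> v; rewrite !Fp.
- by move=> e; rewrite Fx Fy.
- by move=> e; rewrite Fy Fx.
Qed.

End LeavittPathAlgebra.

(** * The algebra of the trivial group: relations and universal property *)

Section TrivialGroupAlgebra.
Context {R : comPzRingType} {c : ring_involution R} {E : digraph}.
Local Notation S := (trivial_group_algebra c E).
Local Notation p := (@p0 R c E).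
Local Notation s := (@s0 R c E).

Lemma star_p0 (v : vertex E) : star (p v) = p v.
Proof. exact: (sgen_rel c (trivial_p_star R v)). Qed.

Lemma p0_mul (v w : vertex E) : p v ** p w = if v == w then p v else 0.
Proof. by have := sgen_rel c (trivial_pp R v w); case: ifP. Qed.

Lemma p0_s0 (v : vertex E) (e : edge E) :
  p v ** s e = if v == rg e then s e else 0.
Proof. by have := sgen_rel c (trivial_ps R v e); case: ifP. Qed.

Lemma s0_p0 (e : edge E) (v : vertex E) :
  s e ** p v = if v == src e then s e else 0.
Proof. by have := sgen_rel c (trivial_sp R e v); case: ifP. Qed.

Lemma star_s0_s0 (e f : edge E) :
  star (s e) ** s f = if e == f then p (src e) else 0.
Proof.
by have := sgen_rel c (trivial_E_family (efam_ss R e f)); case: ifP.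
Qed.

Lemma p0_sum (v : vertex E) : finite_set (receives v) ->
  p v = \sum_(e <- fset_set (receives v)) s e ** star (s e).
Proof.
move=> vfin; have := sgen_rel c (trivial_E_family (efam_sum R vfin)).
by rewrite teval_tsum big_map.
Qed.

Lemma trivial_group_algebra_ext (A : starAlgType c) (F G : S -> A) :
  linear F -> {morph F : a b / a ** b} -> {morph F : a / star a} ->
  linear G -> {morph G : a b / a ** b} -> {morph G : a / star a} ->
  (forall v, F (p v) = G (p v)) -> (forall e, F (s e) = G (s e)) -> F =1 G.
Proof.
move=> Flin FM Fs Glin GM Gs Fp Fe.
apply: (presented_ext (fun=> star)) => //.
- by case=> a; apply: Fs.
- by case=> a; apply: Gs.
- by case.
Qed.

(** The remaining [E]-family relations follow from these hypotheses: idempotence and orthogonality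
    are the two cases of [hpp], and [T e] is a partial isometry by [hss] and [hsp]. *)
Lemma trivial_group_algebraP {A : starAlgType c} (P : vertex E -> A)
    (T : edge E -> A) :
    (forall v, star (P v) = P v) ->
    (forall v w, P v ** P w = if v == w then P v else 0) ->
    (forall v e, P v ** T e = if v == rg e then T e else 0) ->
    (forall e v, T e ** P v = if v == src e then T e else 0) ->
    (forall e f, star (T e) ** T f = if e == f then P (src e) else 0) ->
    (forall v, finite_set (receives v) ->
       P v = \sum_(e <- fset_set (receives v)) T e ** star (T e)) ->
  exists F : S -> A, [/\ linear F, {morph F : a b / a ** b},
    {morph F : a / star a}, forall v, F (p v) = P v & forall e, F (s e) = T e].
Proof.
move=> hstar hpp hps hsp hss hsum.
pose f (g : efam_gen E) := match g with gen_p0 v => P v | gen_s0 e => T e end.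
have [|F [[Flin FM Fs Fgen] _]] :=
    @universal_star_algebraP _ c _ (@trivial_group_rel R E) A f.
  move=> t u []{t u} /= => [t u []{t u} /=|v|v w|v e|e v] //.
  - by move=> v; rewrite hpp eqxx.
  - by move=> v w /negPf vw; rewrite hpp vw.
  - by move=> e; rewrite -nmulA hss eqxx hsp eqxx.
  - by move=> e e'; rewrite hss; case: ifP.
  - by move=> v vfin; rewrite teval_tsum big_map hsum.
  - by rewrite hpp; case: ifP.
  - by rewrite hps; case: ifP.
  - by rewrite hsp; case: ifP.
by exists F; split=> // g; apply: Fgen.
Qed.

End TrivialGroupAlgebra.

Theorem proposition1p15 (R : comPzRingType) (E : digraph)
    (hfin : row_finite E) (hsrc : no_sources E) :
  exists pi1 : {linear leavitt R E
                -> trivial_group_algebra (trivial_involution R) E},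
    [/\ bijective pi1,
        {morph pi1 : a b / a ** b},
        forall v : vertex E, pi1 (lp R v) = p0 (trivial_involution R) v,
        forall e : edge E, pi1 (lx R e) = s0 (trivial_involution R) e
      & forall e : edge E,
          pi1 (ly R e) = star (s0 (trivial_involution R) e)].
Proof.
set c := trivial_involution R.
have [|||||||F [Flin FM Fp Fx Fy]] :=
  @leavittP R E _ (@p0 R c E) (@s0 R c E) (fun e => star (s0 c e)).
- exact: p0_mul.
- by move=> e; rewrite p0_s0 eqxx.
- by move=> e; rewrite s0_p0 eqxx.
(* The relations for [star (s0 c e)] are the adjoints of those for [s0 c e], as [p0] is
   self-adjoint. *)
- by move=> e; rewrite -{1}star_p0 -starM s0_p0 eqxx.
- by move=> e; rewrite -{1}star_p0 -starM p0_s0 eqxx.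
- exact: star_s0_s0.
- by move=> v _; apply: p0_sum.
have [st [stK stM stlin [stp stx sty]]] := @leavitt_involution R E.
(* Since [c] is the identity, linearity of [st] is exactly the axiom [starP]. *)
pose LS : starAlgType c := HB.pack (NUAlgebra.sort (leavitt R E))
  (NUAlgebra.class (leavitt R E))
  (isStarAlgebra.Build R c (leavitt R E) stK stM stlin).
have [||||||G [Glin GM Gs Gp Ge]] :=
  @trivial_group_algebraP R c E LS (@lp R E) (@lx R E).
- exact: stp.
- exact: lpp.
(* Inserting [p (rg e)] in front of [x e] leaves a product of two vertex projections. *)
- move=> v e; rewrite -{1}lpx nmulA lpp.
  by case: eqP => [->|_]; rewrite ?lpx ?nmul0r.
- move=> e v; rewrite -{1}lxp -nmulA lpp eq_sym.
  by case: eqP => _; rewrite ?lxp ?nmulr0.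
- by move=> e f; rewrite -lyx -stx.
(* At a source the [E]-family relation has an empty sum and would force [p v] to be 0, which the
   Leavitt relations do not impose; [hsrc] excludes this case. *)
- move=> v vfin; rewrite [LHS](lp_sum v (hsrc v) vfin).
  by apply: eq_bigr => e _; rewrite -stx.
have Fst a : F (st a) = star (F a).
  (* Conjugating [F] by the two involutions gives again an algebra homomorphism, so comparison on
     generators suffices. *)
  have starF : star \o F \o st =1 F.
    apply: leavitt_ext => //=.
    - by move=> k u v /=; rewrite stlin Flin starP.
    - by move=> u v /=; rewrite stM FM starM.
    - by move=> v; rewrite stp Fp star_p0.
    - by move=> e; rewrite stx Fy Fx; apply: starK.
    - by move=> e; rewrite sty Fx Fy.
  by rewrite -[F a]starF; apply/esym/starK.
have GF : cancel F G.
  apply: (@leavitt_ext R E _ (G \o F) id) => //=.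
  - by move=> k u v /=; rewrite Flin Glin.
  - by move=> u v /=; rewrite FM GM.
  - by move=> v; rewrite Fp Gp.
  - by move=> e; rewrite Fx Ge.
  - by move=> e; rewrite Fy Gs Ge; apply: stx.
(* Uniqueness on this side concerns maps preserving [star], whence the need for [Fst]. *)
have FG : cancel G F.
  apply: (@trivial_group_algebra_ext R c E _ (F \o G) id) => //=.
  - by move=> k u v /=; rewrite Glin Flin.
  - by move=> u v /=; rewrite GM FM.
  - by move=> u /=; rewrite Gs; apply: Fst.
  - by move=> v; rewrite Gp Fp.
  - by move=> e; rewrite Ge Fx.
pose FL : {linear leavitt R E -> trivial_group_algebra c E} :=
  HB.pack F (GRing.isLinear.Build R (leavitt R E) _ _ F Flin).
by exists FL; split=> //; exists G.
Qed.
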